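(* Let $P$ be a finite ranked poset of rank $2$ that is sufficiently covered. If $\bar R_1>0$, then $\chi_{gr}(P)>0$.
   Context: For a poset $P$, write $a \prec b$ if $b$ covers $a$. A rank function for $P$ is a function $\rho: P \to \{0,1,\dots,r\}$ such that $\rho(a)=0$ for every minimal element $a$, and $\rho(b)=\rho(a)+1$ whenever $a \prec b$. $P$ is ranked if it has a rank function; its rank is the smallest possible such $r$. For $i$ let $P_i=\{x\in P\mid\rho(x)=i\}$ and $p_i=|P_i|$. The ranked Euler characteristic of a finite ranked poset of rank $r$ is $\chi_{gr}(P)=\sum_{i=0}^r(-1)^ip_i$. For $x\in P_i$: $A_i(x)=|\{y\in P_{i+1}\mid x\prec y\}|$, $B_i(x)=|\{z\in P_{i-1}\mid z\prec x\}|$, $U_i(x)=\sum_{y\succ x}B_{i+1}(y)$, $D_i(x)=\sum_{z\prec x}A_{i-1}(z)$. For rank $2$, $R_1(e)=1+6A_1(e)+\tfrac32B_1(e)-U_1(e)-D_1(e)$ for $e\in P_1$. Define the averages $\bar R_1=\frac1{p_1}\sum_{e\in P_1}R_1(e)$, $\bar A_1=\frac1{p_1}\sum_{e\in P_1}A_1(e)$, $\bar B_1=\frac1{p_1}\sum_{e\in P_1}B_1(e)$. $P$ is sufficiently covered if $(\bar A_1+\bar B_1)^2-6\bar A_1-\tfrac32\bar B_1-1\ge0$. *)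

(* Defs.v *)
From HB Require Import structures.
From mathcomp Require Export all_boot all_order all_algebra.
Set Implicit Arguments.
Unset Strict Implicit.
Unset Printing Implicit Defensive.
Import Order.TTheory GRing.Theory Num.Theory.
Local Open Scope ring_scope.

Section RankedPosets.
Variables (d : Order.disp_t) (P : finPOrderType d).
Implicit Types x y z a b c : P.

Definition covered a b : bool :=
  (a < b)%O && [forall c, ~~ ((a < c)%O && (c < b)%O)].

Definition minimal_elt a : Prop := forall b, ~~ (b < a)%O.

(* The codomain {0, ..., r} is 'I_r.+1; rho need not be surjective. *)
Definition is_rank_function (r : nat) (rho : P -> 'I_r.+1) : Prop :=
  (forall a, minimal_elt a -> rho a = 0%N :> nat) /\
  (forall a b, covered a b -> rho b = (rho a).+1 :> nat).

Definition has_rank_function (r : nat) : Prop :=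
  exists rho : P -> 'I_r.+1, is_rank_function rho.

Definition ranked_of_rank (r : nat) : Prop :=
  has_rank_function r /\ (forall s : nat, has_rank_function s -> (r <= s)%N).

Variables (r : nat) (rho : P -> 'I_r.+1).

(* The index is an integer so that the level below level 0 is empty. *)
Definition level (i : int) : {set P} := [set x | (rho x : nat)%:Z == i].

Definition chi_gr : int := \sum_(i < r.+1) (-1) ^+ i * #|level (i : nat)%:Z|%:Z.

Definition up_deg (i : int) x : nat := #|[set y in level (i + 1) | covered x y]|.

Definition down_deg (i : int) x : nat := #|[set z in level (i - 1) | covered z x]|.

Definition up_sum (i : int) x : nat := (\sum_(y | covered x y) down_deg (i + 1) y)%N.

Definition down_sum (i : int) x : nat := (\sum_(z | covered z x) up_deg (i - 1) z)%N.

End RankedPosets.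

Section RankTwo.
Variables (d : Order.disp_t) (P : finPOrderType d) (rho : P -> 'I_3).
Implicit Types e : P.

Definition R1 e : rat :=
  1 + 6%:R * (up_deg rho 1 e)%:R + 3%:R / 2%:R * (down_deg rho 1 e)%:R
    - (up_sum rho 1 e)%:R - (down_sum rho 1 e)%:R.

Definition avg1 (f : P -> rat) : rat :=
  (\sum_(e in level rho 1) f e) / #|level rho 1|%:R.

Definition R1_avg : rat := avg1 R1.
Definition A1_avg : rat := avg1 (fun e => (up_deg rho 1 e)%:R).
Definition B1_avg : rat := avg1 (fun e => (down_deg rho 1 e)%:R).

Definition sufficiently_covered : Prop :=
  0 <= (A1_avg + B1_avg) ^+ 2 - 6%:R * A1_avg - 3%:R / 2%:R * B1_avg - 1.

End RankTwo.

(* Main.v *)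
Require Import Defs.
From mathcomp Require Import lra.
Import Order.TTheory GRing.Theory Num.Theory.
Local Open Scope ring_scope.

(** Let [p0], [p1], [p2] be the sizes of the levels, [s] the number of covering
    pairs, and [t = s / p1] the sum of the averages of [A_1] and [B_1].
    Double counting turns [\sum_e (U_1 e + D_1 e)] into the sum [S] of the
    squared degrees over levels 0 and 2, so that summing [0 <= (deg x - t)^2]
    over these levels yields [2 t s <= S + t^2 (p0 + p2)].
    Positivity of the average of [R_1] and sufficient covering give
    [S < t^2 p1], and [s = t p1], hence [t^2 p1 < t^2 (p0 + p2)]. *)

(** Exchanging the sums, each [y] contributes [f y] once per related [e] in [E]. *)
Lemma double_count {T : finType} (r : rel T) (E Y : {set T}) (f : T -> nat) :
  (\sum_(e in E) \sum_(y in Y | r e y) f y =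
   \sum_(y in Y) #|[set e in E | r e y]| * f y)%N.
Proof.
rewrite (exchange_big_dep (mem Y)) /=; last by move=> e y _ /andP[].
apply: eq_bigr => y yY; rewrite -sum_nat_const.
by apply: eq_bigl => e; rewrite inE yY.
Qed.

(** Sums [2 t k <= k^2 + t^2] over [Y], where [k] is the number of elements of [E] related to
    [y]. *)
Lemma incidence_young {F : realFieldType} {T : finType} (r : rel T)
    (E Y : {set T}) (t : F) :
  2 * t * (\sum_(e in E) #|[set y in Y | r e y]|)%N%:R <=
  (\sum_(e in E) \sum_(y in Y | r e y) #|[set e' in E | r e' y]|)%N%:R
    + t ^+ 2 * #|Y|%:R.
Proof.
have -> : (\sum_(e in E) #|[set y in Y | r e y]| =
           \sum_(e in E) \sum_(y in Y | r e y) 1)%N.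
  by apply: eq_bigr => e _; rewrite -sum1_card; apply: eq_bigl => y; rewrite inE.
(* Weight 1 gives the sum of the degrees, weight [k] that of their squares. *)
rewrite !double_count -sumr_const !natr_sum !mulr_sumr -big_split /=.
apply: ler_sum => y _; rewrite muln1 natrM mulr1.
by have := sqr_ge0 (#|[set e in E | r e y]|%:R - t); nra.
Qed.

Lemma covered_level {d : Order.disp_t} {P : finPOrderType d} {r : nat}
    {rho : P -> 'I_r.+1} {a b : P} (i : int) :
  is_rank_function rho -> covered a b ->
  (a \in level rho i) = (b \in level rho (i + 1)).
Proof.
by case=> _ rhoS /rhoS rhob; rewrite !inE rhob -(addn1 (rho a)) PoszD (inj_eq (addIr 1)).
Qed.

Lemma chi_gr_rank2 (d : Order.disp_t) (P : finPOrderType d) (rho : P -> 'I_3) :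
  chi_gr rho = #|level rho 0|%:Z - #|level rho 1|%:Z + #|level rho 2|%:Z.
Proof.
rewrite /chi_gr !big_ord_recr big_ord0 /= add0r expr0 expr1 mul1r mulN1r.
by rewrite sqrrN expr1n mul1r.
Qed.

Theorem theorem2p7 (d : Order.disp_t) (P : finPOrderType d) (rho : P -> 'I_3)
    (hP : ranked_of_rank P 2) (hrho : is_rank_function rho)
    (hcov : sufficiently_covered rho) (hR : 0 < R1_avg rho) :
  0 < chi_gr rho.
Proof.
set E := level rho 1; set p1 : rat := #|E|%:R.
have p1_gt0 : 0 < p1.
  (* Division by zero yields 0, so an empty level 1 would make the average of [R1] vanish. *)
  rewrite lt0r ler0n andbT; apply/eqP => p10.
  by move: hR; rewrite /R1_avg /avg1 -/E -/p1 p10 invr0 mulr0 ltxx.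
have avgK f : \sum_(e in E) f e = avg1 rho f * p1.
  by rewrite /avg1 divfK ?gt_eqF.
set t := A1_avg rho + B1_avg rho.
have upE : (\sum_(e in E) up_sum rho 1 e = \sum_(e in E)
    \sum_(y in level rho 2 | covered e y) #|[set e' in E | covered e' y]|)%N.
  (* The index [1 + 1 - 1] in [down_deg] computes to 1, so only the summation ranges differ. *)
  apply: eq_bigr => e eE; apply: eq_bigl => y.
  by case: (boolP (covered e y)) => [/(covered_level 1 hrho)<-|]; rewrite ?eE ?andbF.
have downE : (\sum_(e in E) down_sum rho 1 e = \sum_(e in E)
    \sum_(z in level rho 0 | covered z e) #|[set e' in E | covered z e']|)%N.
  apply: eq_bigr => e eE; apply: eq_bigl => z.
  by case: (boolP (covered z e)) => [/(covered_level 0 hrho)->|]; rewrite ?eE ?andbF.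
have := incidence_young (fun e y => covered e y) E (level rho 2) t.
have := incidence_young (fun e z => covered z e) E (level rho 0) t.
rewrite -upE -downE !natr_sum.
rewrite (avgK (fun e => (up_deg rho 1 e)%:R)) (avgK (fun e => (down_deg rho 1 e)%:R)).
rewrite -/(A1_avg rho) -/(B1_avg rho) => young0 young2.
have : 0 < \sum_(e in E) R1 rho e by rewrite avgK mulr_gt0.
rewrite /R1 !big_split /= !sumrN -!mulr_sumr sumr_const -/p1.
rewrite (avgK (fun e => (up_deg rho 1 e)%:R)) (avgK (fun e => (down_deg rho 1 e)%:R)).
rewrite -/(A1_avg rho) -/(B1_avg rho) => sumR_gt0.
have covp1 := mulr_ge0 hcov (ltW p1_gt0).
have : 0 < t ^+ 2 * (#|level rho 0|%:R + #|level rho 2|%:R - p1).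
  (* Adding all four inequalities cancels the linear terms in the averages and both double sums. *)
  by rewrite /t in young0 young2 *; lra.
have [->|t_neq0] := eqVneq t 0; first by rewrite expr0n mul0r ltxx.
rewrite pmulr_rgt0 ?exprn_even_gt0 // chi_gr_rank2 => p02_gt.
by rewrite -(ltr0z rat) !(rmorphD, rmorphN) /= -!pmulrn addrAC.
Qed.
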